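(* Suppose that $X_1,\dots,X_n$ are max-independent positive random variables with distribution functions $F_1,\dots,F_n$ respectively and with a given generator $\eta(x_1,\dots,x_n)$. Suppose further that $F_i(x)>0$ for $x>0$, $1\le i\le n$. Define $$Y_1=\max(a_1X_1,\dots,a_nX_n)\quad\text{and}\quad Y_2=\max(b_1X_1,\dots,b_nX_n),$$ where $a_i>0$, $b_i>0$ for $1\le i\le n$ are given constants with $a_i/b_i\neq a_j/b_j$ for $1\le i\neq j\le n$. Then the joint distribution of $(Y_1,Y_2)$ uniquely determines the distribution functions of $X_i$, $1\le i\le n$. That is, if $X_1^*,\dots,X_n^*$ are max-independent positive random variables with the same generator $\eta$ and with distribution functions $F_1^*,\dots,F_n^*$ satisfying $F_i^*(x)>0$ for $x>0$, $1\le i\le n$, and if $(\max_i a_iX_i^*,\max_i b_iX_i^* )$ has the same joint distribution as $(Y_1,Y_2)$, then $F_i^*=F_i$ for $1\le i\le n$.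
   Context: A finite collection of real random variables $X_1,\dots,X_n$ with joint distribution function $F(x_1,\dots,x_n)=P(X_1\le x_1,\dots,X_n\le x_n)$ and marginal distribution functions $F_i(x)=P(X_i\le x)$ is called max-independent if there exists a function $\eta:\mathbb{R}^n\to(0,1]$ such that $$F(x_1,\dots,x_n)=F_1(x_1)\cdots F_n(x_n)\,\eta(x_1,\dots,x_n)\quad\text{for all } x_1,\dots,x_n\in\mathbb{R},$$ and $\eta(x_1,\dots,x_n)\to 1$ if $x_i\to\infty$ for some $i$ (that is, for each $i$, as $x_i\to\infty$ with the other coordinates fixed). The function $\eta$ is called a generator of $(X_1,\dots,X_n)$. *)

(* Defs.v *)
From HB Require Import structures.
From mathcomp Require Import all_boot all_order all_algebra.
From mathcomp Require Import all_classical all_reals all_analysis measurable_realfun.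

Set Implicit Arguments.
Unset Strict Implicit.
Unset Printing Implicit Defensive.

Import Order.TTheory GRing.Theory Num.Theory.
Import numFieldNormedType.Exports.

Local Open Scope classical_set_scope.
Local Open Scope ring_scope.

Definition joint_cdf (d : measure_display) (T : measurableType d)
    (R : realType) (P : probability T R) (n : nat)
    (X : 'I_n -> {RV P >-> R}) (x : 'I_n -> R) : \bar R :=
  P [set w | forall i, X i w <= x i].

(* X is max-independent with generator eta. In the last clause, dfwith x i t is
   the point x with its i-th coordinate replaced by t. *)
Definition max_independent_with (d : measure_display) (T : measurableType d)
    (R : realType) (P : probability T R) (n : nat)
    (eta : ('I_n -> R) -> R) (X : 'I_n -> {RV P >-> R}) : Prop :=
  [/\ forall x, 0 < eta x <= 1,
      forall x, joint_cdf X x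
                = ((\prod_(i < n) cdf (X i) (x i)) * (eta x)%:E)%E
    & forall (x : 'I_n -> R) (i : 'I_n),
        eta (dfwith x i t) @[t --> +oo] --> (1 : R)].

Section max_scaled.
Context (d : measure_display) (T : measurableType d) (R : realType)
  (P : probability T R) (n : nat).
Implicit Types (a b : 'I_n.+1 -> R) (X : 'I_n.+1 -> {RV P >-> R}).

(* The index set is nonempty, so seeding the maximum with its first term gives
   the maximum of exactly the a i * X i w, whatever their signs. *)
Definition max_scaled a X (w : T) : R :=
  \big[Num.max/a ord0 * X ord0 w]_(i < n.+1) (a i * X i w).

Lemma measurable_max_scaled a X : measurable_fun [set: T] (max_scaled a X).
Proof.
rewrite /max_scaled.
elim: (index_enum 'I_n.+1) => [|i s IH].
  under eq_fun do rewrite big_nil.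
  exact: measurable_funM.
under eq_fun do rewrite big_cons.
by apply: measurable_maxr => //; exact: measurable_funM.
Qed.

HB.instance Definition _ a X :=
  isMeasurableFun.Build _ _ T R (max_scaled a X) (measurable_max_scaled a X).

Definition max_scaled_pair a b X (w : T) : R * R :=
  (max_scaled a X w, max_scaled b X w).

Lemma measurable_max_scaled_pair a b X :
  measurable_fun [set: T] (max_scaled_pair a b X).
Proof.
by apply: measurable_fun_pair; exact: measurable_max_scaled.
Qed.

HB.instance Definition _ a b X :=
  isMeasurableFun.Build _ _ T (R * R)%type (max_scaled_pair a b X)
    (measurable_max_scaled_pair a b X).

End max_scaled.

(* Main.v *)
Require Import Defs.
From HB Require Import structures.
From mathcomp Require Import all_boot all_order all_algebra.
From mathcomp Require Import all_classical all_reals all_analysis.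

Import Order.TTheory GRing.Theory Num.Theory.
Import numFieldNormedType.Exports.

Local Open Scope classical_set_scope.
Local Open Scope ring_scope.

(** The joint distribution function of [(Y1, Y2)] at [(s, t)] is that of the
    [X i] at the point [m] with coordinates [m i = min (s / a i) (t / b i)],
    hence equals [(\prod_i F_i (m i)) * eta m]. The second family gives the same
    expression with its own marginals, and the positive factor [eta m] cancels:
    the ratios [h i = F'_i / F_i] of the marginals satisfy
    [\prod_i h i (min (s / a i) (t / b i)) = 1] for all [s, t > 0], and each
    [h i] tends to 1 at infinity.

    This equation forces [h i = 1] on the positive axis. Put [c i = a i / b i];
    the minimum is [s / a i] when [s / t <= c i] and [t / b i] otherwise. While
    [s / t] stays between two consecutive values of [c], the equation reads
    [A s * B t = 1], where [A] is the product over the larger values of [c].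
    Moving [s] within this range at fixed [t] shows that [A] is invariant under
    some dilation of ratio greater than 1 (lemma [prod_tail_eq1]); as [A] tends
    to 1 at infinity, [A = 1] (lemma [dilation_invariant_cvg]). Since the
    [c i] are pairwise distinct, [h i] is the quotient of two such tail
    products, the one over [c j >= c i] and the one over [c j > c i], so it is
    1 (lemma [eq1_of_prod_min_eq1]). On the nonpositive axis the distribution
    functions all vanish, by positivity of the variables. *)

(** The orbit of [x] under the dilation tends to infinity and [Q] is constant
    along it, so the limit of [Q] is already its value at [x]. *)
Lemma dilation_invariant_cvg (R : realType) (l rho : R) (Q : R -> R) :
  1 < rho -> (forall x, 0 < x -> Q (rho * x) = Q x) ->
  Q x @[x --> +oo] --> l -> forall x, 0 < x -> Q x = l.
Proof.
move=> rho1 Qrho Ql x x0.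
have rho0 : 0 < rho by exact: lt_trans ltr01 rho1.
have Qexp m : Q (rho ^+ m * x) = Q x.
  elim: m => [|m IH]; first by rewrite mul1r.
  by rewrite exprS -mulrA Qrho// mulr_gt0// exprn_gt0.
have orbit : rho ^+ m * x @[m --> \oo] --> +oo.
  apply/cvgryPge => A.
  have A1 : 0 < Num.max A 1 by rewrite lt_max ltr01 orbT.
  have /cvg_expr/cvgr0Pnorm_lt/(_ _ (divr_gt0 x0 A1)) : `|rho^-1| < 1.
    by rewrite gtr0_norm ?invr_gt0// invf_lt1.
  apply: filterS => m; rewrite gtr0_norm ?exprn_gt0 ?invr_gt0//.
  rewrite exprVn ltr_pdivlMr// mulrC ltr_pdivrMr ?exprn_gt0// mulrC => /ltW.
  by apply: le_trans; rewrite le_max lexx.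
have : Q (rho ^+ m * x) @[m --> \oo] --> l by exact: cvg_comp orbit Ql.
under eq_cvg do rewrite Qexp.
move=> /(cvg_unique _ (cvg_cst _)) ->//.
Qed.

Lemma cvg_prod_scaled (R : realType) (I : finType) (S : pred I)
    (h : I -> R -> R) (a : I -> R) :
  (forall i, 0 < a i) -> (forall i, h i x @[x --> +oo] --> (1 : R)) ->
  \prod_(i | S i) h i (x / a i) @[x --> +oo] --> (1 : R).
Proof.
move=> a0 h1; have prod1 : \prod_(i | S i) (1 : R) = 1 by rewrite big1.
rewrite -[X in _ --> X]prod1.
apply: cvg_big => [|i _]; first exact: mul_continuous.
apply: (cvg_comp _ _ _ (h1 i)).
by apply: gt0_cvgMly; [rewrite invr_gt0|exact: cvg_id].
Qed.

Section scaled_products.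
Context (R : realType) (I : finType) (a b : I -> R) (h : I -> R -> R).
Hypotheses (a_gt0 : forall i, 0 < a i) (b_gt0 : forall i, 0 < b i).
Hypothesis h_cvg1 : forall i, h i x @[x --> +oo] --> (1 : R).
Hypothesis prod_h : forall s t : R, 0 < s -> 0 < t ->
  \prod_i h i (Num.min (s / a i) (t / b i)) = 1.

(** For a ratio [s / t] that no [a i / b i] separates from the threshold [r],
    the minimum picks [s] on the indices above [r] and [t] on the others, which
    separates the two variables of the functional equation. *)
Lemma prod_split (r s t : R) : 0 < s -> 0 < t ->
  (forall i, (r <= a i / b i) = (s / t <= a i / b i)) ->
  (\prod_(i | r <= a i / b i) h i (s / a i)) *
    (\prod_(i | ~~ (r <= a i / b i)) h i (t / b i)) = 1.
Proof.
move=> s0 t0 rE; rewrite -[RHS](prod_h s t s0 t0).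
rewrite [RHS](bigID (fun i => r <= a i / b i))/=.
have le_div i : (s / t <= a i / b i) = (s / a i <= t / b i).
  rewrite ler_pdivrMr// mulrAC ler_pdivlMr// [RHS]ler_pdivrMr//.
  by rewrite [in RHS]mulrAC [in RHS]ler_pdivlMr// [t * _]mulrC.
congr (_ * _); apply: eq_bigr => i; rewrite rE le_div.
- by move=> /min_idPl ->.
- by rewrite -ltNge => /ltW/min_idPr ->.
Qed.

(** No [a i / b i] lies between [r1] included and [r2] excluded, so keeping
    [t] fixed and moving [s / t] from [r1] to [r2] leaves the factor in [t]
    unchanged, hence also the tail product, which is thereby invariant under the
    dilation of ratio [r2 / r1]. *)
Lemma prod_tail_eq1 (r1 r2 : R) : 0 < r1 -> r1 < r2 ->
  (forall i, (r1 <= a i / b i) = (r2 <= a i / b i)) ->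
  forall s, 0 < s -> \prod_(i | r2 <= a i / b i) h i (s / a i) = 1.
Proof.
move=> r1_gt0 r12 gap.
have r2_gt0 : 0 < r2 by exact: lt_trans r12.
pose A s := \prod_(i | r2 <= a i / b i) h i (s / a i).
apply: (@dilation_invariant_cvg _ 1 (r2 / r1) A).
- by rewrite ltr_pdivlMr// mul1r.
- move=> s s0; pose t := s / r1.
  have t0 : 0 < t by rewrite divr_gt0.
  have st : s / t = r1 by rewrite /t invf_div mulrC divfK// gt_eqF.
  have rst : r2 / r1 * s / t = r2 by rewrite -mulrA st divfK// gt_eqF.
  have rs0 : 0 < r2 / r1 * s by rewrite !mulr_gt0// invr_gt0.
  have E1 := @prod_split r2 s t s0 t0.
  have E2 := @prod_split r2 _ t rs0 t0.
  rewrite st in E1; rewrite rst in E2.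
  have {}E1 := E1 (fun i => esym (gap i)).
  have {}E2 := E2 (fun=> erefl).
  have B0 : \prod_(i | ~~ (r2 <= a i / b i)) h i (t / b i) != 0.
    by apply: contra_eq_neq E1 => ->; rewrite mulr0 eq_sym oner_neq0.
  by apply: (mulIf B0); rewrite E1 E2.
- exact: cvg_prod_scaled.
Qed.

(** The factor at [i] is isolated as the quotient of the tail products over
    [a j / b j >= a i / b i] and over [a j / b j > a i / b i], which differ by
    the single index [i] because the [a j / b j] are distinct. *)
Lemma eq1_of_prod_min_eq1 :
  (forall i j, i != j -> a i / b i != a j / b j) ->
  forall i x, 0 < x -> h i x = 1.
Proof.
move=> ab_neq i x x0.
pose c j := a j / b j.
have c_gt0 j : 0 < c j by rewrite divr_gt0.
(* There are finitely many values of c, so some r < c i exceeds all those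
   below c i, and some r2 > c i lies under all those above c i. *)
have [r [r_gt0 r_lt rP]] :
    exists r, [/\ 0 < r, r < c i & forall j, c j < c i -> c j < r].
  apply: (@filter_ex _ (c i)^'-).
  near=> r; split; near: r; [exact: nbhs_left_gt|exact: nbhs_left_lt|].
  apply: filter_forall => j; have [ji|_] := boolP (c j < c i).
    by apply: filterS (nbhs_left_gt ji).
  exact: nearW.
have [r2 [r2_gt r2P]] :
    exists r, c i < r /\ forall j, c i < c j -> r < c j.
  apply: (@filter_ex _ (c i)^'+).
  near=> r'; split; near: r'; first exact: nbhs_right_gt.
  apply: filter_forall => j; have [ji|_] := boolP (c i < c j).
    by apply: filterS (nbhs_right_lt ji).
  exact: nearW.
have [r1 ir1 r12] : exists2 r, c i < r & r < r2.
  by exists ((c i + r2) / 2); rewrite ?midf_lt.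
have s_gt0 : 0 < x * a i by rewrite mulr_gt0.
have closed_tail : \prod_(j | c i <= c j) h j (x * a i / a j) = 1.
  apply: (@prod_tail_eq1 r) => // j.
  apply/idP/idP => [|/(lt_le_trans r_lt)/ltW//].
  by apply: contraTT; rewrite -!ltNge; exact: rP.
have open_tail : \prod_(j | r2 <= c j) h j (x * a i / a j) = 1.
  apply: (@prod_tail_eq1 r1) => //; first exact: lt_trans ir1.
  move=> j; apply/idP/idP => [|/(lt_le_trans r12)/ltW//].
  by move=> /(lt_le_trans ir1)/r2P/ltW.
move: closed_tail; rewrite (bigD1 i)//= mulfK ?gt_eqF//.
rewrite (eq_bigl (fun j => r2 <= c j)) ?open_tail ?mulr1// => j.
apply/andP/idP => [[cij ji]|r2j].
  by apply/ltW/r2P; rewrite lt_neqAle cij andbT ab_neq// eq_sym.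
have ij : c i < c j by exact: lt_le_trans r2j.
by rewrite ltW//; split=> //; apply: contraTneq ij => ->; rewrite ltxx.
Unshelve. all: by end_near. Qed.

End scaled_products.

Section random_variables.
Context (R : realType) (d : measure_display) (T : measurableType d)
  (P : probability T R).

Lemma cdf_nonpos (X : {RV P >-> R}) :
  {ae P, forall w, 0 < X w} -> forall x : R, x <= 0 -> cdf X x = 0%E.
Proof.
move=> Xpos x x0; rewrite /cdf /distribution/= /pushforward.
apply: measure_negligible; first exact: measurable_funPTI.
apply: negligibleS Xpos => w /=; rewrite in_itv/= => Xx.
by apply/negP; rewrite -leNgt (le_trans Xx).
Qed.

Lemma distribution_max_scaled_pair (n : nat) (X : 'I_n.+1 -> {RV P >-> R})
    (a b : 'I_n.+1 -> R) (s t : R) :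
  (forall i, 0 < a i) -> (forall i, 0 < b i) ->
  distribution P (max_scaled_pair a b X) (`]-oo, s] `*` `]-oo, t])
  = joint_cdf X (fun i => Num.min (s / a i) (t / b i)).
Proof.
move=> a0 b0; rewrite /distribution/= /pushforward /joint_cdf; congr (P _).
have maxP (c : 'I_n.+1 -> R) w u : (forall i, 0 < c i) ->
    max_scaled c X w <= u <-> forall i, X i w <= u / c i.
  move=> c0; split => [/bigmax_leP[_ Xu] i|Xu].
    by rewrite ler_pdivlMr// mulrC Xu.
  by apply/bigmax_leP; split => [|i _]; rewrite mulrC -ler_pdivlMr.
apply/seteqP; split => w /=.
  rewrite !in_itv/= => -[/(maxP _ _ _ a0) Xs /(maxP _ _ _ b0) Xt] i.
  by rewrite le_min Xs Xt.
move=> Xst; rewrite !in_itv/=; split; apply/maxP => // i;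
  by have := Xst i; rewrite le_min => /andP[].
Qed.

Lemma cdf_fin_num (X : {RV P >-> R}) (x : R) : cdf X x \is a fin_num.
Proof. exact: fin_num_measure. Qed.

Lemma joint_cdf_max_independent (n : nat) (eta : ('I_n -> R) -> R)
    (X : 'I_n -> {RV P >-> R}) (x : 'I_n -> R) :
  max_independent_with eta X ->
  joint_cdf X x = ((\prod_(i < n) fine (cdf (X i) (x i))) * eta x)%:E.
Proof.
move=> [_ -> _]; rewrite EFinM -prodEFin; congr (_ * _)%E.
by apply: eq_bigr => i _; rewrite fineK// cdf_fin_num.
Qed.

End random_variables.

Theorem theorem5p2 (R : realType) (n : nat)
  (d : measure_display) (T : measurableType d) (P : probability T R)
  (d' : measure_display) (T' : measurableType d') (P' : probability T' R)
  (eta : ('I_n.+1 -> R) -> R)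
  (X : 'I_n.+1 -> {RV P >-> R}) (X' : 'I_n.+1 -> {RV P' >-> R})
  (a b : 'I_n.+1 -> R)
  (X_maxindep : max_independent_with eta X)
  (X'_maxindep : max_independent_with eta X')
  (X_pos : forall i, {ae P, forall w, 0 < X i w})
  (X'_pos : forall i, {ae P', forall w, 0 < X' i w})
  (cdfX_gt0 : forall i (x : R), 0 < x -> (0 < cdf (X i) x)%E)
  (cdfX'_gt0 : forall i (x : R), 0 < x -> (0 < cdf (X' i) x)%E)
  (a_gt0 : forall i, 0 < a i)
  (b_gt0 : forall i, 0 < b i)
  (ab_neq : forall i j, i != j -> a i / b i != a j / b j)
  (same_joint : forall B : set (R * R), measurable B ->
     distribution P (max_scaled_pair a b X) B
     = distribution P' (max_scaled_pair a b X') B) :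
  forall (i : 'I_n.+1) (x : R), cdf (X' i) x = cdf (X i) x.
Proof.
move=> i x; have [x_le0|x_gt0] := leP x 0; first by rewrite !cdf_nonpos.
pose F j y := fine (cdf (X j) y).
pose F' j y := fine (cdf (X' j) y).
have F_gt0 j y : 0 < y -> 0 < F j y.
  by move=> y_gt0; rewrite fine_gt0// cdfX_gt0//= ltey_eq cdf_fin_num.
have F'_gt0 j y : 0 < y -> 0 < F' j y.
  by move=> y_gt0; rewrite fine_gt0// cdfX'_gt0//= ltey_eq cdf_fin_num.
have F_cvg1 j : F j y @[y --> +oo] --> (1 : R) by exact/fine_cvg/cvg_cdfy1.
have F'_cvg1 j : F' j y @[y --> +oo] --> (1 : R) by exact/fine_cvg/cvg_cdfy1.
suff /(divr1_eq) F'F : F' i x / F i x = 1.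
  by rewrite -[LHS]fineK ?cdf_fin_num// -/(F' i x) F'F fineK ?cdf_fin_num.
apply: (@eq1_of_prod_min_eq1 R _ a b (fun j y => F' j y / F j y)) => //.
- by move=> j; rewrite -[X in _ --> X](divr1 (1 : R)); apply: cvgM => //; apply: cvgV.
- move=> s t s_gt0 t_gt0.
  set m := fun j => Num.min (s / a j) (t / b j).
  have m_gt0 j : 0 < m j by rewrite lt_min !divr_gt0.
  have quadrant : measurable (`]-oo, s] `*` `]-oo, t]).
    by apply: measurableX; exact: measurable_itv.
  have := same_joint _ quadrant.
  rewrite !distribution_max_scaled_pair// -/m.
  rewrite !(@joint_cdf_max_independent _ _ _ _ _ eta)//.
  have [/(_ m)/andP[eta_gt0 _] _ _] := X_maxindep.
  (* Both sides carry the factor eta m, evaluated at the same point. *)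
  move=> [] /(mulIf (lt0r_neq0 eta_gt0)) FF'.
  by rewrite prodf_div -FF' divff// gt_eqF// prodr_gt0// => j _; exact: F_gt0.
Qed.
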